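(* Let $X$ and $Y$ be Banach spaces, and let $Q:Y\to X$ be a quotient map. If $Q$ admits a coarse section $X\to Y$, then $Q$ admits a continuous coarse section $X\to Y$. In particular, in this case there exists a map $Y\to\mathrm{Ker}(Q)\oplus X$ which is simultaneously a homeomorphism (onto $\mathrm{Ker}(Q)\oplus X$) and a coarse equivalence.
   Context: A quotient map between Banach spaces is a bounded surjective linear map. For $A\subset X$, a section of $Q$ on $A$ is a (not necessarily linear or continuous) map $f:A\to Y$ with $Q\circ f=\mathrm{Id}_A$. For a map $f:(M,d)\to(N,\partial)$ between metric spaces and $t\ge 0$, let $\omega_f(t)=\sup\{\partial(f(x),f(y)) : d(x,y)\le t\}$ and $\rho_f(t)=\inf\{\partial(f(x),f(y)) : d(x,y)\ge t\}$ (with $\inf\emptyset=\infty$). $f$ is coarse if $\omega_f(t)<\infty$ for all $t\ge 0$; expanding if $\lim_{t\to\infty}\rho_f(t)=\infty$; a coarse equivalence if it is coarse, expanding, and cobounded, i.e. $\sup_{y\in N}\partial(y,f(M))<\infty$. *)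

(* Defs.v *)
From HB Require Import structures.
From mathcomp Require Import all_boot all_order all_algebra.
From mathcomp Require Import all_classical all_reals all_analysis.
Set Implicit Arguments.
Unset Strict Implicit.
Unset Printing Implicit Defensive.
Import Order.TTheory GRing.Theory Num.Theory.
Import numFieldNormedType.Exports.
Local Open Scope classical_set_scope.
Local Open Scope ring_scope.

(* The metric spaces are given by explicit distance functions, because the
   library does not make normed modules instances of [metricType]. *)
Section CoarseMaps.
Context (R : realType) (M N : Type).
Variables (dM : M -> M -> R) (dN : N -> N -> R).
Implicit Types (f : M -> N) (t : R).

Definition omega f t : \bar R :=
  ereal_sup [set (dN (f p.1) (f p.2))%:E | p in [set p | dM p.1 p.2 <= t]].

(* [ereal_inf set0 = +oo] *)
Definition rho f t : \bar R :=
  ereal_inf [set (dN (f p.1) (f p.2))%:E | p in [set p | t <= dM p.1 p.2]].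

Definition coarse f : Prop := forall t, 0 <= t -> (omega f t < +oo)%E.

Definition expanding f : Prop := rho f t @[t --> +oo] --> +oo%E.

Definition dist_to_set (y : N) (A : set N) : \bar R :=
  ereal_inf [set (dN y z)%:E | z in A].

Definition cobounded f : Prop :=
  (ereal_sup [set dist_to_set y (range f) | y in [set: N]] < +oo)%E.

Definition coarse_equivalence f : Prop :=
  [/\ coarse f, expanding f & cobounded f].

End CoarseMaps.

Definition norm_dist (R : realType) (V : normedModType R) (x y : V) : R :=
  `|x - y|.
Arguments norm_dist {R} V x y.

Definition homeomorphism (S T : topologicalType) (h : S -> T) : Prop :=
  continuous h /\ exists g : T -> S, [/\ cancel h g, cancel g h & continuous g].

Section QuotientMaps.
Context (R : realType) (Y X : normedModType R).
Implicit Type Q : {linear Y -> X}.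

(* For a linear map, [bounded_near Q (nbhs 0)] is boundedness as an operator,
   see [linear_boundedP]. *)
Definition quotient_map Q : Prop :=
  bounded_near Q (nbhs (0 : Y)) /\ set_surj [set: Y] [set: X] Q.

Definition is_section Q (f : X -> Y) : Prop := Q \o f = id.

End QuotientMaps.

Section Kernel.
Context (R : realType) (Y X : normedModType R) (Q : {linear Y -> X}).

Definition ker_pred : {pred Y} := fun y => Q y == 0.

Fact ker_pred_submod : submod_closed ker_pred.
Proof.
split=> [|a u v]; rewrite !unfold_in; first by rewrite linear0.
by move=> /eqP Qu /eqP Qv; rewrite linearP Qu Qv scaler0 addr0.
Qed.

HB.instance Definition _ := GRing.isSubmodClosed.Build R Y ker_pred
  ker_pred_submod.

Record ker : predArgType := Ker { ker_val :> Y; _ : ker_val \in ker_pred }.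

HB.instance Definition _ := [isSub for ker_val].
HB.instance Definition _ := [Choice of ker by <:].
HB.instance Definition _ := [SubChoice_isSubLmodule of ker by <:].

Let ker_norm (k : ker) : R := `|ker_val k|.

Let ker_normD (k l : ker) : ker_norm (k + l) <= ker_norm k + ker_norm l.
Proof. exact: ler_normD. Qed.

Let ker_normZ (a : R) (k : ker) : ker_norm (a *: k) = `|a| * ker_norm k.
Proof. exact: normrZ. Qed.

Let ker_norm0_eq0 (k : ker) : ker_norm k = 0 -> k = 0.
Proof. by move=> /normr0_eq0 k0; apply: val_inj. Qed.

HB.instance Definition _ := Lmodule_isNormed.Build R ker
  ker_normD ker_normZ ker_norm0_eq0.

End Kernel.

(* Main.v *)
Require Import Defs.
From HB Require Import structures.
From mathcomp Require Import all_boot all_order all_algebra.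
From mathcomp Require Import all_classical all_reals all_analysis.
From mathcomp Require wochoice.
From mathcomp Require Import lra ring.
Import Order.TTheory GRing.Theory Num.Theory.
Import numFieldNormedType.Exports.
Local Open Scope classical_set_scope.
Local Open Scope ring_scope.

(** A coarse section [f] moves by a bounded amount on sets of bounded diameter,
so replacing [f x] by a convex combination of values [f c] with [c] within 1/2
of [x] costs only a bounded error.  Stone's construction of partitions of
unity on metric spaces lets these combinations depend continuously on [x]
([continuous_average]).  The resulting continuous map [g] is at bounded
distance from [f], hence coarse, but it is only an approximate section: by
linearity [Q (g x)] is a convex combination of points within 1/2 of [x], so
[`|x - Q (g x)| <= 1/2].

The same [g] also repairs itself.  Since [Q (f 0) = 0], the continuous map
[k = g - f 0] also inverts [Q] with error at most 1/2, and it is bounded on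
the unit ball because [f] is coarse.  Applying [k] to
the rescaled error [2^n (x - Q (G_n x))] of an approximate section [G_n] and
adding the result, scaled back, halves the error, while [G_n] moves by
[O(2^-n)].  The limit is an exact section, continuous because the convergence
is uniform, and still at bounded distance from [f]
([continuous_section_near]).

Given a continuous coarse section [f], the map [y |-> (y - f (Q y), Q y)] has
the continuous inverse [(k, x) |-> k + f x], and both are controlled at large
scale by the norm of [Q] and the modulus of [f]. *)

(** * Continuous averages over small balls *)

(** Well-order the index type and select the first member of the cover that
contains each point; [lt] is the strict part of the well-order, of which the
trichotomy and the minimality of [m x] are recorded. *)
Lemma least_index (T : choiceType) (V : Type) (U : T -> set V) :
  (forall x, exists i, U i x) ->
  exists (lt : T -> T -> Prop) (m : V -> T),
    [/\ forall i j, i <> j -> lt i j \/ lt j i,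
        forall x, U (m x) x & forall x i, lt i (m x) -> ~ U i x].
Proof.
move=> cov.
have [le wo_le] := wochoice.well_ordering_principle T.
have min x : {m | U m x /\ forall i, U i x -> le m i}.
  apply: cid; have [i Ui] := cov x.
  have [|m [[mU mmin] _]] := wo_le [pred j | `[< U j x >]].
    by exists i; apply/asboolP.
  exists m; split; first exact/asboolP.
  by move=> j Uj; apply: mmin; apply/asboolP.
have pair i j : i <> j -> ~~ le j i \/ ~~ le i j.
  move=> neq; have [|m [[_ mmin] muniq]] := wo_le [pred k | (k == i) || (k == j)].
    by exists i; rewrite !inE eqxx.
  have [ji|] := boolP (le j i); last by left.
  have [ij|] := boolP (le i j); last by right.
  have lerefl k : le k k.
    have [|z [[zk zmin] _]] := wo_le (pred1 k); first by exists k; rewrite inE.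
    by move: (zmin k); rewrite !inE in zk *; rewrite (eqP zk); exact.
  have mi : m = i.
    apply: muniq; split; first by rewrite !inE eqxx.
    by move=> k; rewrite !inE => /orP[]/eqP->.
  have mj : m = j.
    apply: muniq; split; first by rewrite !inE eqxx orbT.
    by move=> k; rewrite !inE => /orP[]/eqP->.
  by case: neq; rewrite -mi.
exists (fun i j => ~~ le j i), (fun x => sval (min x)); split => //.
- by move=> x; case: (svalP (min x)).
- by move=> x i /negP + Ui; apply; case: (svalP (min x)) => _; exact.
Qed.

Section Bumps.
Context {R : realType} {X : normedModType R}.
Implicit Types (x y : X).

(** Around each point of a [d]-separated family at most one piece comes within
distance [d / 2].  The index [c x] of that piece is therefore locally constant
on the support of a Urysohn function that equals 1 close to the family and
vanishes at distance [d / 4] from it.  The default [t0] keeps [c x] meaningful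
where [x] is far from all pieces. *)
Lemma discrete_bump (T : choiceType) (S : T -> set X) (t0 : X -> T) (d : R) : 0 < d ->
  (forall i j s t, i <> j -> S i s -> S j t -> d <= `|s - t|) ->
  exists (phi : X -> R) (c : X -> T),
    [/\ continuous phi,
        forall x, 0 <= phi x <= 1,
        forall i s, S i s -> \forall y \near s, phi y = 1,
        forall x, exists i, \forall y \near x, phi y = 0 \/ c y = i &
        forall x, (exists2 s, S (c x) s & `|x - s| < d / 2) \/ c x = t0 x].
Proof.
move=> d0 sep.
pose A := [set x | forall i s, S i s -> d / 4 <= `|x - s|].
pose B := [set x | exists i, exists2 s, S i s & `|x - s| < d / 8].
have : uniform_separator A B.
  apply: uniform_separatorW.
  exists [set p : X * X | ball p.1 (d / 8) p.2].
    apply: (@entourage_ball R X (PosNum (_ : 0 < d / 8))).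
    by rewrite divr_gt0.
  apply/seteqP; split => // -[x y] /= [[Ax [i [s Ss ys]]]].
  rewrite -ball_normE /= => xy; have := Ax _ _ Ss.
  have := ler_distD y x s; lra.
move=> /(@uniform_separatorP _ R)[phi [cphi phi01 phi0 phi1]].
pose near_piece x i := exists2 s, S i s & `|x - s| < d / 2.
pose c x := xget (t0 x) (near_piece x).
have near_uniq x i j : near_piece x i -> near_piece x j -> i = j.
  move=> [s Ss xs] [t St xt]; apply: contrapT => ij.
  have := sep _ _ _ _ ij Ss St.
  have := ler_distD x s t; rewrite (distrC s x); lra.
have near_c x i : near_piece x i -> c x = i.
  move=> ni; rewrite /c; case: xgetP => [j _ nj|/(_ i)//]; exact: near_uniq nj ni.
exists phi, c; split.
- exact: cphi.
- by move=> x; have /= := phi01 (phi x) (ex_intro2 _ _ x I erefl); rewrite in_itv.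
- move=> i s Ss; have : \forall y \near s, `|s - y| < d / 8.
    by apply: cvgr_dist_lt; [exact: cvg_id | rewrite divr_gt0].
  apply: filterS => y; rewrite distrC => ys.
  by apply: phi1; exists y => //; exists i, s.
- move=> x; exists (c x).
  have [[i nx]|none] := pselect (exists i, exists2 s, S i s & `|x - s| < d / 3).
    have ni : near_piece x i.
      by case: nx => s Ss ?; exists s => //; lra.
    case: nx => s Ss xs.
    have : \forall y \near x, `|x - y| < d / 6.
      by apply: cvgr_dist_lt; [exact: cvg_id | rewrite divr_gt0].
    apply: filterS => y; rewrite distrC => yx; right; rewrite (near_c _ _ ni).
    by apply: near_c; exists s => //; have := ler_distD x y s; lra.
  have : \forall y \near x, `|x - y| < d / 12.
    by apply: cvgr_dist_lt; [exact: cvg_id | rewrite divr_gt0].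
  apply: filterS => y xy; left; apply: phi0; exists y => // i s Ss.
  rewrite leNgt; apply/negP => ys; apply: none; exists i; exists s => //.
  have := ler_distD y x s; lra.
- move=> x; rewrite /c; case: xgetP => [i -> []|_]; last by right.
  by move=> s Ss xs; left; exists s.
Qed.

(** Stone's argument for the cover of the space by balls of radius [r].  Let
[m x] be the first index [i] with [`|x - i| < r], and let [S n i] consist of
the [x] with [m x = i] lying at depth at least [d n = 1 / (n + 1)] in that
ball.  If [i] comes before [j], a point of [S n j] lies outside the ball of
[i], so it is [d n] away from [S n i]: for fixed [n] the pieces are separated.
Every point is deep enough in its ball for some [n]. *)
Lemma locally_constant_bumps (r : R) : 0 < r ->
  exists (phi : nat -> X -> R) (c : nat -> X -> X),
    [/\ forall n, continuous (phi n),
        forall n x, 0 <= phi n x <= 1,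
        forall x, exists n, \forall y \near x, phi n y = 1,
        forall n x, exists i, \forall y \near x, phi n y = 0 \/ c n y = i &
        forall n x, `|x - c n x| < r].
Proof.
move=> r0.
have [|lt [m [tri Um mmin]]] := @least_index X X (fun i => [set x | `|x - i| < r]).
  by move=> x; exists x; rewrite /= subrr normr0.
pose d (n : nat) : R := n.+1%:R^-1.
have d0 n : 0 < d n by rewrite invr_gt0.
pose S n i := [set x | m x = i /\ `|x - i| <= r - d n].
have sep n i j s t : i <> j -> S n i s -> S n j t -> d n <= `|s - t|.
  have half i' j' s' t' : lt i' j' -> S n i' s' -> S n j' t' -> d n <= `|s' - t'|.
    move=> ij [msi si] [mtj tj]; have := mmin t' i'; rewrite mtj /= => /(_ ij) /negP.
    rewrite -leNgt; have := ler_distD s' t' i'; rewrite (distrC t' s'); lra.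
  move=> /tri[ij|ji] Ss St; first exact: half ij Ss St.
  by rewrite distrC; exact: half ji St Ss.
have bump n := @discrete_bump X (S n) id (d n) (d0 n) (sep n).
have [phi /boolp.choice[c phic]] := boolp.choice bump.
exists phi, c; split.
- by move=> n; have [] := phic n.
- by move=> n; have [] := phic n.
- move=> x; have := Um x; rewrite /= -subr_gt0 => gap.
  have [n ngap] : exists n, d n < r - `|x - m x|.
    exists (Num.truncn (r - `|x - m x|)^-1); rewrite /d -[ltRHS]invrK.
    by rewrite ltf_pV2 ?posrE ?invr_gt0// truncnS_gt.
  exists n; have [_ _ + _ _] := phic n; apply; split; first by [].
  by lra.
- by move=> n; have [] := phic n.
- move=> n x; have [_ _ _ _ /(_ x)[[s [_ sc] xs]|]] := phic n; last first.
    by move=> ->; rewrite subrr normr0.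
  (* [x] is [d n / 2]-close to a point of depth [d n], hence in the ball. *)
  have := ler_distD s x (c n x); have := d0 n; lra.
Qed.

End Bumps.

Section ContinuousAverage.
Context {R : realType} {X Y : normedModType R}.

(** The bumps [phi n] become a partition of unity with weights
[phi n * \prod_(m < n) (1 - phi m)].  Since some [phi n] equals 1 around each
point, all later weights vanish nearby and the sum is locally a fixed finite
one; its terms are continuous because the centres [c n] are locally constant
where [phi n] does not vanish. *)
Lemma continuous_average (f : X -> Y) (r : R) : 0 < r ->
  exists g : X -> Y, continuous g /\
    forall x, exists (n : nat) (w : nat -> R) (c : nat -> X),
      [/\ forall i, 0 <= w i, \sum_(i < n) w i = 1,
          forall i, `|x - c i| < r & g x = \sum_(i < n) w i *: f (c i)].
Proof.
move=> r0; have [phi [c [phic phi01 phi1 cst cr]]] := @locally_constant_bumps R X r r0.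
pose rest n x := \prod_(m < n) (1 - phi m x).
pose w x n := rest n x * phi n x.
pose G n x := \sum_(m < n) w x m *: f (c m x).
have rest_ge0 n x : 0 <= rest n x.
  by apply: prodr_ge0 => m _; have := phi01 m x; lra.
have w_ge0 x n : 0 <= w x n by rewrite mulr_ge0//; have /andP[] := phi01 n x.
have w_sum x n : \sum_(m < n) w x m = 1 - rest n x.
  elim: n => [|n IH]; first by rewrite /rest !big_ord0 subrr.
  by rewrite big_ord_recr /= IH /w /rest big_ord_recr /=; ring.
have rest0_le m n x : (m <= n)%N -> rest m x = 0 -> rest n x = 0.
  move=> + rm; elim: n => [|n IH]; first by rewrite leqn0 => /eqP <-.
  rewrite leq_eqVlt => /orP[/eqP <-//|/IH rn].
  by rewrite /rest big_ord_recr /= -/(rest n x) rn mul0r.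
have G_le m n x : (m <= n)%N -> rest m x = 0 -> G n x = G m x.
  move=> + rm; elim: n => [|n IH]; first by rewrite leqn0 => /eqP <-.
  rewrite leq_eqVlt => /orP[/eqP <-//|mn].
  by rewrite /G big_ord_recr /= -/(G n x) IH// /w (rest0_le m)// mul0r scale0r addr0.
have restS n : rest n.+1 = (fun x => rest n x * (1 - phi n x)).
  by apply/funext => x; rewrite /rest big_ord_recr.
have GS n : G n.+1 = (fun x => G n x + rest n x *: (phi n x *: f (c n x))).
  by apply/funext => x; rewrite /G big_ord_recr /= scalerA.
have rest_cont n : continuous (rest n).
  elim: n => [|n IH] x.
    by rewrite /rest; under eq_fun do rewrite big_ord0; exact: cvg_cst.
  rewrite restS; apply: cvgM; first exact: IH.
  by apply: cvgB; [exact: cvg_cst|exact: phic].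
have term_cont n : continuous (fun x => phi n x *: f (c n x)).
  move=> x; have [i ci] := cst n x.
  have eqi : \forall y \near x, phi n y *: f i = phi n y *: f (c n y).
    by apply: filterS ci => y [->|->]; rewrite ?scale0r.
  rewrite /continuous_at -(nbhs_singleton eqi).
  apply: cvg_trans; first exact: near_eq_cvg eqi.
  by apply: cvgZr_tmp; exact: phic.
have G_cont n : continuous (G n).
  elim: n => [|n IH] x.
    by rewrite /G; under eq_fun do rewrite big_ord0; exact: cvg_cst.
  rewrite GS; apply: cvgD; first exact: IH.
  by apply: cvgZ; [exact: rest_cont|exact: term_cont].
have eventually_rest0 (x : X) : exists n, \forall y \near x, rest n y = 0.
  have [n phin] := phi1 x; exists n.+1; apply: filterS phin => y phin.
  by rewrite /rest big_ord_recr /= phin subrr mulr0.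
have [N restN] := boolp.choice eventually_rest0.
have restNx x : rest (N x) x = 0 := nbhs_singleton (restN x).
exists (fun x => G (N x) x); split.
- move=> x.
  have eqG : \forall y \near x, G (N x) y = G (N y) y.
    apply: filterS (restN x) => y rxy.
    by have [le|/ltnW le] := leqP (N x) (N y); [symmetry|]; exact: G_le.
  rewrite /continuous_at.
  apply: cvg_trans; first exact: near_eq_cvg eqG.
  exact: G_cont.
- move=> x; exists (N x), (w x), (c^~ x); split => //.
  by rewrite w_sum restNx subr0.
Qed.

Lemma norm_convex_comb_le (V : normedModType R) (n : nat) (w : nat -> R)
    (v : nat -> V) (a : V) (K : R) :
  (forall i, 0 <= w i) -> \sum_(i < n) w i = 1 ->
  (forall i, `|v i - a| <= K) -> `|\sum_(i < n) w i *: v i - a| <= K.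
Proof.
move=> w0 w1 vK; rewrite -[a]scale1r -w1 scaler_suml -sumrB.
rewrite (le_trans (ler_norm_sum _ _ _))// -[K]mul1r -w1 mulr_suml.
by apply: ler_sum => i _; rewrite -scalerBr normrZ ger0_norm// ler_wpM2l.
Qed.

End ContinuousAverage.

(** * Turning an approximate section into a section *)

Section UniformLimit.
Context {R : realType}.

Lemma near_mul_pow_half_lt (K e : R) : 0 < e ->
  \forall n \near \oo, K * 2^-1 ^+ n < e.
Proof.
move=> e0; have half : `|2^-1 : R| < 1 by rewrite ger0_norm//; lra.
exact: (cvgr_lt 0 (cvg_geometric K half) e e0).
Qed.

(** The explicit rate is kept: with [n = 0] it bounds the distance from the
starting map to the limit. *)
Lemma geometric_continuous_limit (T : topologicalType)
    (V : completeNormedModType R) (G : nat -> T -> V) (C : R) :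
  0 <= C -> (forall n, continuous (G n)) ->
  (forall n x, `|G n.+1 x - G n x| <= C * 2^-1 ^+ n) ->
  exists F : T -> V, continuous F /\
    forall n x, `|G n x - F x| <= 2 * C * 2^-1 ^+ n.
Proof.
move=> C0 Gc step.
have tail x n m : (n <= m)%N ->
    `|G n x - G m x| <= 2 * C * (2^-1 ^+ n - 2^-1 ^+ m).
  elim: m => [|m IH]; first by rewrite leqn0 => /eqP->; rewrite !subrr normr0 mulr0.
  rewrite leq_eqVlt => /orP[/eqP->|/IH nm]; first by rewrite !subrr normr0 mulr0.
  rewrite (le_trans (ler_distD (G m x) _ _))//.
  by have := step m x; rewrite (distrC (G m.+1 x)) exprS; lra.
have tail_le x n m : (n <= m)%N -> `|G n x - G m x| <= 2 * C * 2^-1 ^+ n.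
  move=> nm; rewrite (le_trans (tail x n m nm))//.
  by apply: ler_wpM2l; rewrite ?mulr_ge0// gerBl exprn_ge0.
have Gcvg x : exists l : V, G n x @[n --> \oo] --> l.
  suff : cvg (G n x @[n --> \oo]) by exists (lim (G n x @[n --> \oo])).
  apply: cauchy_cvg; apply: cauchy_exP => e e0.
  have [N _ /(_ N (leqnn N)) small] := near_mul_pow_half_lt (2 * C) e e0.
  exists (G N x); exists N => // m /= Nm; rewrite -ball_normE /=.
  exact: le_lt_trans (tail_le _ _ _ Nm) small.
have [F Fl] := boolp.choice Gcvg.
have GF n x : `|G n x - F x| <= 2 * C * 2^-1 ^+ n.
  apply/ler_addgt0Pr => e e0.
  have near_m : \forall m \near \oo, `|F x - G m x| < e by exact: cvgr_dist_lt.
  have [m [nm Fm]] : exists m, (n <= m)%N /\ `|F x - G m x| < e.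
    near \oo => m; exists m; split; near: m => //; exact: nbhs_infty_ge.
  have := ler_distD (G m x) (G n x) (F x); have := tail_le x n m nm.
  by rewrite (distrC (G m x)); lra.
exists F; split => // x.
apply/(@cvgrPdist_lt _ _ _ (nbhs x)) => e e0.
have e3 : 0 < e / 3 by rewrite divr_gt0.
have [n _ /(_ n (leqnn n)) /= small] := near_mul_pow_half_lt (2 * C) (e / 3) e3.
have : \forall y \near x, `|G n x - G n y| < e / 3.
  by apply: cvgr_dist_lt; [exact: Gc | rewrite divr_gt0].
apply: filterS => y Gxy.
have := ler_distD (G n x) (F x) (F y); have := ler_distD (G n y) (G n x) (F y).
have := GF n x; have := GF n y; rewrite (distrC (F x) (G n x)); lra.
Unshelve. all: by end_near.
Qed.

End UniformLimit.

Section ExactSection.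
Context {R : realType} {X : normedModType R} {Y : completeNormedModType R}.
Variable Q : {linear Y -> X}.
Hypothesis Qc : continuous Q.

(** Newton-like iteration: [k] is an approximate inverse of [Q] with error 1/2
on the unit ball.  Rescaling by [2 ^+ n] brings the error of the [n]-th
approximation back to the unit ball, where [k] is bounded by [C], so each step
halves the error and moves by at most [C * 2^-1 ^+ n]. *)
Lemma continuous_section_near (g k : X -> Y) (C : R) :
  continuous g -> (forall x, `|x - Q (g x)| <= 1) ->
  continuous k -> (forall u, `|u - Q (k u)| <= 2^-1) ->
  (forall u, `|u| <= 1 -> `|k u| <= C) ->
  exists f : X -> Y,
    [/\ continuous f, is_section Q f & forall x, `|g x - f x| <= 2 * C].
Proof.
move=> gc Qg kc Qk kC.
pose err (h : X -> Y) n x := 2 ^+ n *: (x - Q (h x)).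
pose G := fix G n := if n is m.+1
  then fun x => G m x + 2^-1 ^+ m *: k (err (G m) m x) else g.
have pow2 n : (2 : R) ^+ n * 2^-1 ^+ n = 1 by rewrite -exprMn divff ?expr1n.
have Gc n : continuous (G n).
  elim: n => [//|n IH] x /=.
  apply: cvgD; first exact: IH.
  apply: cvgZl_tmp; apply: (@continuous_comp _ _ _ (err (G n) n) k); last exact: kc.
  apply: cvgZl_tmp; apply: cvgB; first exact: cvg_id.
  by apply: continuous_comp; [exact: IH|exact: Qc].
have errG n x : `|err (G n) n x| <= 1.
  elim: n => [|n IH]; first by rewrite /err expr0 scale1r.
  have -> : err (G n.+1) n.+1 x = 2 *: (err (G n) n x - Q (k (err (G n) n x))).
    rewrite {1}/err /= (linearD Q) (linearZ_LR Q) /= opprD addrA scalerBr scalerA.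
    by rewrite exprS -mulrA pow2 mulr1 -scalerA -scalerBr.
  by rewrite normrZ ger0_norm//; have := Qk (err (G n) n x); lra.
have [||f [fc Gf]] := @geometric_continuous_limit R X Y G C _ Gc.
  by rewrite (le_trans _ (kC 0 _)) ?normr0.
  move=> n x; rewrite /= addrC addKr normrZ ger0_norm ?exprn_ge0//.
  by rewrite mulrC ler_wpM2r ?exprn_ge0// kC.
exists f; split => //; last by move=> x; have := Gf 0 x; rewrite expr0 mulr1.
apply/funext => x /=.
have Qcvg : Q (G n x) @[n --> \oo] --> Q (f x).
  apply: continuous_cvg; first exact: Qc.
  apply/cvgrPdist_le => e e0.
  have := near_mul_pow_half_lt (2 * C) e e0; apply: filterS => n /ltW.
  by rewrite distrC; exact: le_trans.
have Qid : Q (G n x) @[n --> \oo] --> x.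
  apply/cvgrPdist_le => e e0.
  have := near_mul_pow_half_lt 1 e e0; apply: filterS => n /ltW.
  apply: le_trans; rewrite mul1r.
  have := errG n x; rewrite /err normrZ ger0_norm ?exprn_ge0// => le1.
  have half_ge0 : 0 <= 2^-1 ^+ n :> R by rewrite exprn_ge0.
  have := ler_wpM2l half_ge0 le1.
  by rewrite mulrA (mulrC _ (2 ^+ n)) pow2 mul1r mulr1.
exact: (cvg_unique _ Qcvg Qid).
Qed.

End ExactSection.

(** * Quantitative forms of the coarse notions *)

Section CoarseBounds.
Context {R : realType} {M N : Type} (dM : M -> M -> R) (dN : N -> N -> R).

Lemma coarseP (f : M -> N) : coarse dM dN f <->
  forall t, 0 <= t -> exists K, forall x y, dM x y <= t -> dN (f x) (f y) <= K.
Proof.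
split=> [fc t t0|fc t t0].
  have le_sup x y : dM x y <= t -> ((dN (f x) (f y))%:E <= omega dM dN f t)%E.
    by move=> xy; apply: ereal_sup_ubound; exists (x, y).
  case: (omega dM dN f t) le_sup (fc t t0) => [K||] le_sup // _.
    by exists K => x y /le_sup; rewrite lee_fin.
  by exists 0 => x y /le_sup.
have [K fK] := fc t t0.
apply: (@le_lt_trans _ _ K%:E); last exact: ltry.
by apply: ge_ereal_sup => _ [[x y] /= xy <-]; rewrite lee_fin fK.
Qed.

Lemma expandingP (f : M -> N) :
  (forall s, exists t, forall x y, dN (f x) (f y) <= s -> dM x y <= t) ->
  expanding dM dN f.
Proof.
move=> fe; apply/cvgeyPge => s; have [t ft] := fe s.
near=> u; apply: le_ereal_inf_tmp => _ [[x y] /= xy <-]; rewrite lee_fin.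
rewrite leNgt; apply/negP => /ltW /ft; apply/negP; rewrite -ltNge.
apply: lt_le_trans xy; near: u; by apply: nbhs_pinfty_gt; exact: num_real.
Unshelve. all: by end_near.
Qed.

Lemma surjective_cobounded (f : M -> N) : (forall y, dN y y = 0) ->
  (forall y, exists x, f x = y) -> cobounded dN f.
Proof.
move=> dN0 fsurj; apply: (@le_lt_trans _ _ 0%E); last exact: ltry.
apply: ge_ereal_sup => _ [y _ <-]; apply: ereal_inf_lbound.
by have [x fx] := fsurj y; exists y; [exists x|rewrite dN0].
Qed.

End CoarseBounds.

Lemma coarse_close (R : realType) (X Y : normedModType R) (f g : X -> Y) (D : R) :
  (forall x, `|f x - g x| <= D) -> coarse (norm_dist X) (norm_dist Y) f ->
  coarse (norm_dist X) (norm_dist Y) g.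
Proof.
move=> fg /coarseP fc; apply/coarseP => t /fc[K fK].
exists (2 * D + K) => x y /fK; rewrite /norm_dist => fxy.
have := ler_distD (f x) (g x) (g y); have := ler_distD (f y) (f x) (g y).
have := fg x; have := fg y; rewrite (distrC (f x) (g x)); lra.
Qed.

(** * Continuous coarse sections and the splitting *)

(** [f] is first averaged at scale 1/2 into [g]; then [g] is both the map to be
corrected and, up to the constant [f 0], the approximate inverse of [Q] used
in the correction. *)
Lemma continuous_coarse_section (R : realType) (X : normedModType R)
    (Y : completeNormedModType R) (Q : {linear Y -> X}) (f : X -> Y) :
  continuous Q -> is_section Q f -> coarse (norm_dist X) (norm_dist Y) f ->
  exists F : X -> Y,
    [/\ is_section Q F, continuous F & coarse (norm_dist X) (norm_dist Y) F].
Proof.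
move=> Qc fs fc; have Qf x : Q (f x) = x by have /(congr1 (@^~ x)) := fs.
have /coarseP bound := fc.
have [K fK] : exists K, forall x y, `|x - y| <= 2^-1 -> `|f x - f y| <= K.
  by apply: bound; rewrite invr_ge0.
have [K1 fK1] : exists K, forall x y, `|x - y| <= 1 -> `|f x - f y| <= K.
  exact: bound.
have half0 : 0 < 2^-1 :> R by rewrite invr_gt0.
have [g [gc gavg]] := @continuous_average R X Y f 2^-1 half0.
have fg x : `|f x - g x| <= K.
  have [n [w [c [w0 w1 cx ->]]]] := gavg x; rewrite distrC.
  by apply: (norm_convex_comb_le Y n w (f \o c)) => // i /=; rewrite distrC fK// ltW.
have Qg x : `|x - Q (g x)| <= 2^-1.
  have [n [w [c [w0 w1 cx ->]]]] := gavg x; rewrite linear_sum distrC.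
  under eq_bigr do rewrite linearZ_LR Qf.
  by apply: (norm_convex_comb_le X n w c) => // i; rewrite distrC ltW.
have [||||F [Fc Fs gF]] := @continuous_section_near R X Y Q Qc g
    (fun x => g x - f 0) (K + K1) gc.
- by move=> x; have := Qg x; lra.
- by move=> x; apply: cvgB; [exact: gc|exact: cvg_cst].
- by move=> u; rewrite linearB Qf subr0.
- move=> u u1; have := fK1 u 0; rewrite subr0 => /(_ u1).
  by have := ler_distD (f u) (g u) (f 0); have := fg u; rewrite (distrC (f u) (g u)); lra.
exists F; split => //; apply: (coarse_close _ _ _ g _ _ gF).
exact: coarse_close fg fc.
Qed.

Section Splitting.
Context {R : realType} {X Y : normedModType R} (Q : {linear Y -> X}) (f : X -> Y).
Hypotheses (Qc : continuous Q) (fs : is_section Q f) (fc : continuous f).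

Let Qf x : Q (f x) = x. Proof. by have /(congr1 (@^~ x)) := fs. Qed.

Let mem_ker y : y - f (Q y) \in ker_pred Q.
Proof. by rewrite unfold_in linearB Qf subrr. Qed.

Let Qker (k : ker Q) : Q (ker_val k) = 0.
Proof. by case: k => v /= vk; apply/eqP. Qed.

Definition splitting (y : Y) : ker Q * X := (Ker (mem_ker y), Q y).

Let glue (p : ker Q * X) : Y := ker_val p.1 + f p.2.

Let splittingK : cancel splitting glue.
Proof. by move=> y; rewrite /glue /= subrK. Qed.

Let glueK : cancel glue splitting.
Proof.
move=> [k x]; have Qg : Q (glue (k, x)) = x by rewrite linearD Qker Qf add0r.
by congr pair => //; apply: val_inj => /=; rewrite Qg addrK.
Qed.

Lemma splitting_homeomorphism : homeomorphism splitting.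
Proof.
split; last (exists glue; split => //).
  move=> y; apply: (@cvg_pair _ _ _ _ (nbhs (Ker (mem_ker y))) (nbhs (Q y)) _ _ _
    (fun z => Ker (mem_ker z)) Q); last exact: Qc.
  apply/cvgrPdist_lt => e e0.
  have : (z - f (Q z)) @[z --> y] --> y - f (Q y).
    apply: cvgB; first exact: cvg_id.
    by apply: continuous_comp; [exact: Qc|exact: fc].
  by move=> /cvgrPdist_lt /(_ e e0).
move=> p; apply: cvgD; last first.
  by apply: continuous_comp; [exact: cvg_snd|exact: fc].
have : fst q @[q --> p] --> p.1 by exact: cvg_fst.
move=> /cvgrPdist_lt near_fst; apply/cvgrPdist_lt => e e0.
exact: near_fst.
Qed.

(** The norm on the product is the maximum of the norms, so a bound [s] on the
distance of the images bounds both [`|Q y - Q z|] and, through the modulus of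
[f], the difference of [f (Q y)] and [f (Q z)]; adding it back to the kernel
components bounds [`|y - z|]. *)
Lemma splitting_coarse_equivalence :
  bounded_near Q (nbhs (0 : Y)) -> coarse (norm_dist X) (norm_dist Y) f ->
  coarse_equivalence (norm_dist Y) (norm_dist (ker Q * X)%type) splitting.
Proof.
move=> /linear_boundedP /pinfty_ex_gt0[B B0 QB] /coarseP fco.
have distE y z : norm_dist (ker Q * X)%type (splitting y) (splitting z) =
    Num.max `|(y - f (Q y)) - (z - f (Q z))| `|Q y - Q z| by [].
have rearrange y z :
    y - f (Q y) - (z - f (Q z)) = (y - z) - (f (Q y) - f (Q z)).
  by rewrite opprD addrACA -opprD.
split.
- apply/coarseP => t t0; have Bt0 : 0 <= B * t by rewrite mulr_ge0// ltW.
  have [K fK] := fco (B * t) Bt0.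
  exists (Num.max (t + K) (B * t)) => y z; rewrite distE /norm_dist => yz.
  have Qyz : `|Q y - Q z| <= B * t.
    by rewrite -linearB (le_trans (QB _))// ler_pM2l.
  rewrite ge_max !le_max Qyz orbT andbT; apply/orP; left.
  by rewrite rearrange (le_trans (ler_normB _ _))// lerD// fK.
- apply: expandingP => s.
  have [s0|s0] := leP 0 s; last first.
    (* a negative bound is met by no pair of images *)
    exists 0 => y z; rewrite distE => /(le_lt_trans)/(_ s0).
    by rewrite ltNge le_max normr_ge0.
  have [K fK] := fco s s0; exists (s + K) => y z.
  rewrite distE ge_max /norm_dist => /andP[kyz /fK]; rewrite /norm_dist => fyz.
  have -> : y - z = (y - f (Q y) - (z - f (Q z))) + (f (Q y) - f (Q z)).
    by rewrite rearrange subrK.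
  exact: le_trans (ler_normD _ _) (lerD kyz fyz).
- apply: surjective_cobounded => [p|p]; first by rewrite /norm_dist subrr normr0.
  by exists (glue p); exact: glueK.
Qed.

End Splitting.

Theorem theorem1p7 (R : realType) (X Y : completeNormedModType R)
    (Q : {linear Y -> X}) :
  quotient_map Q ->
  (exists f : X -> Y,
     is_section Q f /\ coarse (norm_dist X) (norm_dist Y) f) ->
  (exists f : X -> Y,
     [/\ is_section Q f, continuous f
       & coarse (norm_dist X) (norm_dist Y) f]) /\
  (exists h : Y -> (ker Q * X)%type,
     homeomorphism h /\
     coarse_equivalence (norm_dist Y) (norm_dist (ker Q * X)%type) h).
Proof.
move=> [Qb _] [f0 [f0s f0c]].
have Qc : continuous Q by exact: bounded_linear_continuous.
have [f [fs fc fco]] := @continuous_coarse_section R X Y Q f0 Qc f0s f0c.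
split; first by exists f.
exists (splitting Q f fs); split.
- exact: splitting_homeomorphism.
- exact: splitting_coarse_equivalence.
Qed.
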